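(* Let $S,T$ be $\mathrm{Cu}$-semigroups. Then any Cauchy sequence $(\alpha_i)_i$ in $\mathrm{Hom}_{\mathrm{Cu}}(S,T)$ converges towards a unique $\mathrm{Cu}$-morphism $S\to T$.
   Context: **$\mathrm{Cu}$-semigroups.** For $x,y$ in a partially ordered set, $x\ll y$ means: for every increasing sequence $(z_n)_n$ having a supremum with $y\le\sup_n z_n$, there is $n$ with $x\le z_n$. A $\mathrm{Cu}$-semigroup is a positively ordered (commutative) monoid $S$ such that (O1) every increasing sequence has a supremum; (O2) every element is the supremum of a $\ll$-increasing sequence; (O3) $x'\ll x$ and $y'\ll y$ imply $x'+y'\ll x+y$; (O4) $\sup_n(x_n+y_n)=\sup_n x_n+\sup_n y_n$ for increasing sequences. A $\mathrm{Cu}$-morphism is a monoid morphism preserving the order, the relation $\ll$, and suprema of increasing sequences. **Finite-set comparison.** For $\mathrm{Cu}$-morphisms $\alpha,\beta\colon S\to T$ and a finite set $F\subseteq S$, write $\alpha\simeq_F\beta$ if $\alpha(x')\le\beta(x)$ and $\beta(x')\le\alpha(x)$ for all $x',x\in F$ with $x'\ll x$. **Cauchy sequences and convergence.** A sequence $(\alpha_i)_i$ in $\mathrm{Hom}_{\mathrm{Cu}}(S,T)$ is Cauchy if for any finite $F\subseteq S$ there is $i_F$ such that $\alpha_j\simeq_F\alpha_k$ whenever $j,k\ge i_F$. It converges towards a $\mathrm{Cu}$-morphism $\alpha\colon S\to T$ if for any finite $F\subseteq S$ there is $i_F$ such that $\alpha_j\simeq_F\alpha$ whenever $j\ge i_F$.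 *)

(* Defs.v *)
From HB Require Import structures.
From mathcomp Require Import all_boot all_order.
From mathcomp Require Import all_classical.

Set Implicit Arguments.
Unset Strict Implicit.
Unset Printing Implicit Defensive.

Import Order.TTheory.

Local Open Scope classical_set_scope.

Section IncreasingSequences.
Context (d : Order.disp_t) (P : porderType d).

(* "Increasing" is understood in the weak sense. *)
Definition increasing_seq (z : nat -> P) : Prop :=
  {homo z : m n / (m <= n)%N >-> (m <= n)%O}.

Definition is_sup (z : nat -> P) (s : P) : Prop := supremums (range z) s.

Definition way_below (x y : P) : Prop :=
  forall (z : nat -> P) (s : P), increasing_seq z -> is_sup z s ->
    (y <= s)%O -> exists n, (x <= z n)%O.

Definition way_below_increasing (z : nat -> P) : Prop :=
  forall n, way_below (z n) (z n.+1).

End IncreasingSequences.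

(* The monoid is not an nmodType: MathComp already fixes the join of nmodType
   and porderType at ring_display (in POrderedZmodule, which has opposites), so
   that Hierarchy-Builder rejects their join at an arbitrary display. *)
HB.mixin Record isPositivelyOrderedMonoid (d : Order.disp_t) M
    of Order.POrder d M := {
  pozero : M;
  poadd : Monoid.com_law pozero;
  po_ge0 : forall x : M, (pozero <= x)%O;
  po_leD2r : forall x y z : M, (x <= y)%O -> (poadd x z <= poadd y z)%O
}.

#[short(type="poMonoidType")]
HB.structure Definition PositivelyOrderedMonoid (d : Order.disp_t) :=
  { M of Order.POrder d M & isPositivelyOrderedMonoid d M }.

Declare Scope po_monoid_scope.
Delimit Scope po_monoid_scope with PO.
Notation "0" := pozero : po_monoid_scope.
Notation "x + y" := (poadd x y) : po_monoid_scope.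

Local Open Scope po_monoid_scope.

HB.mixin Record isCuSemigroup (d : Order.disp_t) S
    of PositivelyOrderedMonoid d S := {
  cu_O1 : forall z : nat -> S, increasing_seq z -> exists s, is_sup z s;
  cu_O2 : forall x : S,
    exists2 z : nat -> S, way_below_increasing z & is_sup z x;
  cu_O3 : forall x' x y' y : S,
    way_below x' x -> way_below y' y -> way_below (x' + y') (x + y);
  cu_O4 : forall (x y : nat -> S) (s t : S),
    increasing_seq x -> increasing_seq y -> is_sup x s -> is_sup y t ->
    is_sup (fun n => x n + y n) (s + t)
}.

#[short(type="cuSemigroupType")]
HB.structure Definition CuSemigroup (d : Order.disp_t) :=
  { S of PositivelyOrderedMonoid d S & isCuSemigroup d S }.

Section CuMorphisms.
Context (d d' : Order.disp_t) (S : cuSemigroupType d) (T : cuSemigroupType d').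

Record cu_morphism (f : S -> T) : Prop := CuMorphism {
  cu_morph0 : f 0 = 0;
  cu_morphD : {morph f : x y / x + y};
  cu_morph_le : {homo f : x y / (x <= y)%O};
  cu_morph_way_below : forall x y, way_below x y -> way_below (f x) (f y);
  cu_morph_sup : forall (z : nat -> S) (s : S),
    increasing_seq z -> is_sup z s -> is_sup (f \o z) (f s)
}.

Record cuHom : Type := CuHom {
  cuHom_fun :> S -> T;
  cuHomP : cu_morphism cuHom_fun
}.

Definition cu_close (F : set S) (a b : cuHom) : Prop :=
  forall x' x : S, F x' -> F x -> way_below x' x ->
    (a x' <= b x)%O /\ (b x' <= a x)%O.

Definition cu_cauchy (a : nat -> cuHom) : Prop :=
  forall F : set S, finite_set F ->
    exists iF : nat, forall j k : nat, (iF <= j)%N -> (iF <= k)%N ->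
      cu_close F (a j) (a k).

Definition cu_converges (a : nat -> cuHom) (l : cuHom) : Prop :=
  forall F : set S, finite_set F ->
    exists iF : nat, forall j : nat, (iF <= j)%N -> cu_close F (a j) l.

End CuMorphisms.

Arguments cuHom {d d'} S T.

(* Main.v *)
(* The limit sends [x] to the supremum of the elements of [T] that eventually lie
   below [alpha j x'] for some [x' << x]. Along a [<<]-increasing sequence
   [x_n] with supremum [x], the Cauchy condition gives [alpha_j x_n <= alpha_k x_(n+1)]
   for [j, k >= i_n], so that [alpha_(i_n) x_n] increases and is cofinal among those elements;
   hence the supremum exists. The resulting [l] satisfies, for [x' << x] and [j] large,
   [alpha_j x' <= l x] and [l x' <= alpha_j x], and interpolation of [<<]
   transfers the morphism axioms from [alpha_j] to [l] through these two inequalities. *)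
Require Import Defs.
From mathcomp Require Import all_boot all_order.
From mathcomp Require Import all_classical.

Set Implicit Arguments.
Unset Strict Implicit.
Unset Printing Implicit Defensive.

Import Order.TTheory.

Local Open Scope classical_set_scope.
Local Open Scope order_scope.

Section WayBelow.
Context (d : Order.disp_t) (P : porderType d).
Implicit Types (x y : P) (z : nat -> P).

Lemma is_supP z (s : P) :
  is_sup z s <->
  (forall n, z n <= s) /\ (forall u, (forall n, z n <= u) -> s <= u).
Proof.
split=> [[ub lub]|[ub lub]]; split.
- by move=> n; apply: ub; exists n.
- by move=> u zu; apply: lub => _ [n _ <-].
- by move=> _ [n _ <-].
- by move=> u zu; apply: lub => n; apply: zu; exists n.
Qed.

Lemma increasing_seqS z :
  (forall n, z n <= z n.+1) -> increasing_seq z.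
Proof. exact: (homo_leq (@le_refl _ P) (fun _ _ _ => @le_trans _ P _ _ _)). Qed.

Lemma way_belowW x y : way_below x y -> x <= y.
Proof.
(* Testing [way_below x y] on the constant sequence [y] yields [x <= y]. *)
have cst : is_sup (fun=> y) y by apply/is_supP; split=> // u /(_ 0%N).
by case/(_ _ _ (fun _ _ _ => lexx y) cst (lexx y)).
Qed.

Lemma way_below_le x y y' : way_below x y -> y <= y' -> way_below x y'.
Proof. by move=> xy yy' z s zi zs y's; apply: xy zi zs (le_trans yy' y's). Qed.

Lemma le_way_below x x' y : x <= x' -> way_below x' y -> way_below x y.
Proof.
move=> xx' x'y z s zi zs ys; have [n x'z] := x'y z s zi zs ys.
by exists n; apply: le_trans x'z.
Qed.

Lemma way_below_increasing_seq z : way_below_increasing z -> increasing_seq z.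
Proof. by move=> zi; apply: increasing_seqS => n; apply: way_belowW. Qed.

Lemma way_below_is_sup z (s : P) n :
  way_below_increasing z -> is_sup z s -> way_below (z n) s.
Proof. by move=> zi /is_supP[zs _]; apply: way_below_le (zi n) (zs _). Qed.

End WayBelow.

Lemma po_leD (d : Order.disp_t) (M : poMonoidType d) (a b a' b' : M) :
  a <= a' -> b <= b' -> (a + b)%PO <= (a' + b')%PO.
Proof.
move=> aa' bb'; apply: le_trans (po_leD2r _ _ b aa') _.
by rewrite ![poadd a' _]Monoid.mulmC; apply: po_leD2r.
Qed.

(** Some term of a sequence given by [cu_O2] for [y] dominates [x]; the next term interpolates. *)
Lemma way_below_interpolation (d : Order.disp_t) (S : cuSemigroupType d)
    (x y : S) :
  way_below x y -> exists2 w, way_below x w & way_below w y.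
Proof.
move=> xy; have [z zi zy] := cu_O2 y.
have [n xz] := xy _ _ (way_below_increasing_seq zi) zy (lexx y).
exists (z n.+1); first exact: le_way_below xz (zi n).
exact: way_below_is_sup.
Qed.

Lemma finite_eventually (X : choiceType) (A : set X) (Q : X -> nat -> Prop) :
  finite_set A ->
  (forall x, A x -> exists N, forall j, (N <= j)%N -> Q x j) ->
  exists N, forall j, (N <= j)%N -> forall x, A x -> Q x j.
Proof.
move=> /finite_seqP[s ->] ev.
have /choice[N NP] x :
    exists N, x \in s -> forall j, (N <= j)%N -> Q x j.
  case: (boolP (x \in s)) => xs; last by exists 0%N.
  by have [N NP] := ev x xs; exists N.
exists (\max_(x <- s) N x) => j jN x xs; apply: NP => //.
by apply: leq_trans jN; apply: leq_bigmax_seq.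
Qed.

Section CuHomTheory.
Context (d d' : Order.disp_t) (S : cuSemigroupType d) (T : cuSemigroupType d').

Lemma cuHom_ext (f g : cuHom S T) : f =1 g -> f = g.
Proof.
case: f g => [f fP] [g gP] /= /funext fg; case: g / fg gP => gP.
by rewrite (Prop_irrelevance fP gP).
Qed.

Lemma cauchy_way_below (alpha : nat -> cuHom S T) (x y : S) :
  cu_cauchy alpha -> way_below x y ->
  exists N, forall j k, (N <= j)%N -> (N <= k)%N -> alpha j x <= alpha k y.
Proof.
move=> ca xy; have [N NP] := ca [set x; y] (finite_set2 x y).
exists N => j k jN kN.
by have [] := NP j k jN kN x y (or_introl erefl) (or_intror erefl) xy.
Qed.

Lemma converges_way_below (alpha : nat -> cuHom S T) (l : cuHom S T) (x y : S) :
  cu_converges alpha l -> way_below x y ->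
  exists N, forall j, (N <= j)%N -> alpha j x <= l y /\ l x <= alpha j y.
Proof.
move=> cl xy; have [N NP] := cl [set x; y] (finite_set2 x y).
by exists N => j jN; apply: (NP j jN x y (or_introl erefl) (or_intror erefl) xy).
Qed.

(** Along [z] from [cu_O2], [f (z n) <= alpha j (z n.+1) <= g x] for large [j]; take the supremum
    over [n]. *)
Lemma converges_le (alpha : nat -> cuHom S T) (f g : cuHom S T) (x : S) :
  cu_converges alpha f -> cu_converges alpha g -> f x <= g x.
Proof.
move=> cf cg; have [z zi zx] := cu_O2 x.
have /is_supP[_] :=
  cu_morph_sup (cuHomP f) (way_below_increasing_seq zi) zx.
apply=> n /=.
have [N /(_ (maxn N _)) NP] := converges_way_below cf (zi n).
have [M /(_ (maxn _ M)) MP] :=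
  converges_way_below cg (way_below_is_sup n.+1 zi zx).
have [_ fa] := NP _ (leq_maxl N M); have [ag _] := MP _ (leq_maxr N M).
exact: le_trans fa ag.
Qed.

Lemma converges_unique (alpha : nat -> cuHom S T) (f g : cuHom S T) :
  cu_converges alpha f -> cu_converges alpha g -> f = g.
Proof.
move=> cf cg; apply: cuHom_ext => x.
by apply/le_anti; rewrite !(@converges_le alpha).
Qed.

(** A lower limit is taken over the arguments [x'] way below [x], since the Cauchy condition
    compares the maps only across a pair related by [way_below]. *)
Definition eventual_lower (alpha : nat -> cuHom S T) (x : S) : set T :=
  [set t | exists2 x', way_below x' x &
             exists N, forall j, (N <= j)%N -> t <= alpha j x'].

Lemma eventual_lower_sup (alpha : nat -> cuHom S T) (x : S) :
  cu_cauchy alpha -> exists s, supremums (eventual_lower alpha x) s.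
Proof.
move=> ca; have [z zi zx] := cu_O2 x.
have /choice[N NP] := fun n => cauchy_way_below ca (zi n).
(* The running maximum puts both [i n] and [i n.+1] past the threshold [N n]. *)
pose i n := (\max_(k < n.+1) N k)%N.
have Ni n : (N n <= i n)%N by apply: (leq_bigmax (ord_max : 'I_n.+1)).
have iS n : (i n <= i n.+1)%N by rewrite /i [leqRHS]big_ord_recr leq_maxl.
have yi : increasing_seq (fun n => alpha (i n) (z n)).
  apply: increasing_seqS => n; apply: NP => //.
  exact: leq_trans (Ni n) (iS n).
have [s /is_supP[ys sy]] := cu_O1 _ yi; exists s; split.
- move=> t [x' x'x [M MP]].
  have [n x'z] := x'x _ _ (way_below_increasing_seq zi) zx (lexx x).
  apply: le_trans (MP _ (leq_maxl M (N n))) _.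
  apply: le_trans (cu_morph_le (cuHomP _) x'z) _.
  apply: le_trans (ys n.+1); apply: NP; first exact: leq_maxr.
  exact: leq_trans (Ni n) (iS n).
(* Each [alpha (i n) (z n)] is itself an eventual lower bound, witnessed by [z n.+1]. *)
- move=> u ub; apply: sy => n; apply: ub; exists (z n.+1).
    exact: way_below_is_sup.
  by exists (N n) => j jN; apply: NP.
Qed.

Section Limit.
Context (alpha : nat -> cuHom S T) (l : S -> T) (ca : cu_cauchy alpha)
  (lP : forall x, supremums (eventual_lower alpha x) (l x)).

(** For [w] strictly between, [alpha j x' <= alpha k w] for all large [k], so [alpha j x'] belongs
    to [eventual_lower alpha x]. *)
Lemma limit_ge (x x' : S) : way_below x' x ->
  exists N, forall j, (N <= j)%N -> alpha j x' <= l x.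
Proof.
move=> /way_below_interpolation[w x'w wx].
have [N NP] := cauchy_way_below ca x'w.
exists N => j jN; have [ub _] := lP x; apply: ub.
by exists w => //; exists N => k kN; apply: NP.
Qed.

(** With [j] fixed, any [t] in [eventual_lower alpha x'] satisfies [t <= alpha k x' <= alpha j x]
    for some large [k]. *)
Lemma limit_le (x x' : S) : way_below x' x ->
  exists N, forall j, (N <= j)%N -> l x' <= alpha j x.
Proof.
move=> x'x; have [N NP] := cauchy_way_below ca x'x.
exists N => j jN; have [_ lub] := lP x'; apply: lub => t [w wx' [M MP]].
apply: le_trans (MP _ (leq_maxl M N)) _.
apply: le_trans (cu_morph_le (cuHomP _) (way_belowW wx')) _.
by apply: NP => //; apply: leq_maxr.
Qed.

Lemma limit_homo : {homo l : x y / x <= y}.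
Proof.
move=> x y xy; have [_ lub] := lP x; apply: lub => t [x' x'x ev].
by have [ub _] := lP y; apply: ub; exists x' => //; apply: way_below_le xy.
Qed.

Lemma limit_sup (z : nat -> S) (s : S) :
  increasing_seq z -> is_sup z s -> is_sup (l \o z) (l s).
Proof.
move=> zi zs; have /is_supP[ub _] := zs; apply/is_supP; split=> [n|u lu] /=.
  exact/limit_homo/ub.
have [_ lub] := lP s; apply: lub => t [x' /way_below_interpolation[w x'w ws] ev].
(* Since [x'] is way below [w <= z n], the same [x'] witnesses [t] for [z n]. *)
have [n wz] := ws _ _ zi zs (lexx s).
apply: le_trans (lu n); have [+ _] := lP (z n); apply.
by exists x' => //; apply: way_below_le wz.
Qed.

(** Interpolating twice, [l x <= alpha j w], which is way below [alpha j v <= l y], for one large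
    [j]. *)
Lemma limit_way_below (x y : S) :
  way_below x y -> way_below (l x) (l y).
Proof.
move=> /way_below_interpolation[w xw /way_below_interpolation[v wv vy]].
have [N NP] := limit_le xw; have [M MP] := limit_ge vy.
apply: le_way_below (NP _ (leq_maxl N M)) _.
apply: way_below_le (MP _ (leq_maxr N M)).
exact: cu_morph_way_below (cuHomP _) _ _ wv.
Qed.

Lemma limit0 : l 0%PO = 0%PO.
Proof.
apply/le_anti; rewrite po_ge0 andbT.
have [_ lub] := lP 0%PO; apply: lub => t [x' x'0 [N NP]].
rewrite -(cu_morph0 (cuHomP (alpha N))); apply: le_trans (NP N (leqnn N)) _.
exact: cu_morph_le (cuHomP _) _ _ (way_belowW x'0).
Qed.

(** Both sides are suprema along [v n + w n], way-below increasing by [cu_O3]. Each inequality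
    passes through [alpha j (v n.+1 + w n.+1)], where additivity of [alpha j] applies. *)
Lemma limitD : {morph l : x y / (x + y)%PO}.
Proof.
move=> x y; have [v vi vx] := cu_O2 x; have [w wi wy] := cu_O2 y.
have vI := way_below_increasing_seq vi.
have wI := way_below_increasing_seq wi.
have vwi : way_below_increasing (fun n => (v n + w n)%PO).
  by move=> n; apply: cu_O3.
have vwI := way_below_increasing_seq vwi.
have vwxy := cu_O4 _ _ _ _ vI wI vx wy.
have lI (z : nat -> S) : increasing_seq z -> increasing_seq (l \o z).
  by move=> zi m n mn; apply/limit_homo/zi.
have /is_supP[_ lubD] :=
  cu_O4 _ _ _ _ (lI _ vI) (lI _ wI) (limit_sup vI vx) (limit_sup wI wy).
have /is_supP[_ lub] := limit_sup vwI vwxy.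
apply/le_anti/andP; split.
- apply: lub => n /=; have [N NP] := limit_le (vwi n).
  have [K KP] := limit_ge (way_below_is_sup n.+1 vi vx).
  have [M MP] := limit_ge (way_below_is_sup n.+1 wi wy).
  apply: le_trans (NP (maxn N (maxn K M)) _) _; first exact: leq_maxl.
  rewrite (cu_morphD (cuHomP _)); apply: po_leD; [apply: KP|apply: MP].
    by rewrite !leq_max leqnn orbT.
  by rewrite !leq_max leqnn !orbT.
- apply: lubD => n /=.
  have [N NP] := limit_ge (way_below_is_sup n.+1 vwi vwxy).
  have [K KP] := limit_le (vi n); have [M MP] := limit_le (wi n).
  apply: le_trans (NP (maxn N (maxn K M)) _); last exact: leq_maxl.
  rewrite (cu_morphD (cuHomP _)); apply: po_leD; [apply: KP|apply: MP].
    by rewrite !leq_max leqnn orbT.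
  by rewrite !leq_max leqnn !orbT.
Qed.

Lemma limit_cu_morphism : cu_morphism l.
Proof.
split; [exact: limit0 | exact: limitD | exact: limit_homo |
        exact: limit_way_below | exact: limit_sup].
Qed.

Lemma limit_converges : cu_converges alpha (CuHom limit_cu_morphism).
Proof.
(* Putting [way_below] inside [Q] makes the other pairs of [F] vacuous, so a common threshold exists
   over the whole finite product. *)
move=> F finF; pose Q (p : S * S) j :=
  way_below p.1 p.2 -> alpha j p.1 <= l p.2 /\ l p.1 <= alpha j p.2.
have [|N NP] := @finite_eventually _ (F `*` F) Q (finite_setX finF finF).
  move=> [x' x] _; have [x'x|nx'x] := pselect (way_below x' x); last by exists 0%N.
  have [N NP] := limit_ge x'x; have [M MP] := limit_le x'x.
  exists (maxn N M) => j; rewrite geq_max => /andP[jN jM] _.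
  by split; [apply: NP|apply: MP].
by exists N => j jN x' x Fx' Fx; apply: (NP j jN (x', x)).
Qed.

End Limit.

End CuHomTheory.

Theorem theorem3p8 (d d' : Order.disp_t)
    (S : cuSemigroupType d) (T : cuSemigroupType d')
    (alpha : nat -> cuHom S T) :
  cu_cauchy alpha -> exists! l : cuHom S T, cu_converges alpha l.
Proof.
move=> ca; have /choice[l lP] x := eventual_lower_sup x ca.
exists (CuHom (limit_cu_morphism ca lP)).
split=> [|g]; first exact: limit_converges.
exact/converges_unique/limit_converges.
Qed.
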